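(* Let $d$ be a positive integer and let $\pi$ be an irreducible permutation of $\{1,\dots,d\}$ with $\pi=\pi^{-1}$. Then $\pi$ is Lagrangian, i.e. the subspace $H^\pi_V$ is a Lagrangian subspace of the symplectic space $(H^\pi,\omega)$.
   Context: A permutation $\pi$ of $\{1,\dots,d\}$ is irreducible if $\pi(\{1,\dots,k\})=\{1,\dots,k\}$ with $1\le k\le d$ holds only for $k=d$. $\Omega_\pi$ is the antisymmetric $d\times d$ matrix with $(\Omega_\pi)_{i,j}=1$ if $i<j$ and $\pi(i)>\pi(j)$, $(\Omega_\pi)_{i,j}=-1$ if $i>j$ and $\pi(i)<\pi(j)$, and $0$ otherwise. Put $H^\pi=\Omega_\pi\mathbb{R}^d$ with the bilinear form $\omega(\Omega_\pi u,\Omega_\pi v)=u^t\Omega_\pi v$; this is a well-defined symplectic space (of dimension $2g(\pi)$, with $g(\pi)$ the genus of any suspension surface of $\pi$). Let $\mathbb{A}$ be the set of orbits of $\pi$ acting on $\{1,\dots,d\}$. For an orbit $B\in\mathbb{A}$ let $\mathbf{e}_B=\sum_{i\in B}\mathbf{e}_i\in\mathbb{R}^d$, where $\mathbf{e}_i$ are the standard basis vectors. Define $V^\pi=\mathrm{span}\{\mathbf{e}_B: B\in\mathbb{A}\}$ and $H^\pi_V=\Omega_\pi V^\pi$. For a subspace $V$ of a symplectic space $(H,\omega)$, $V^\omega=\{u\in H:\omega(u,v)=0\ \forall v\in V\}$; $V$ is Lagrangian if $V=V^\omega$. *)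

(* Defs.v *)
From mathcomp Require Import all_boot all_order all_fingroup all_algebra.
From mathcomp Require Import reals.

Set Implicit Arguments.
Unset Strict Implicit.
Unset Printing Implicit Defensive.

Import GRing.Theory Num.Theory.
Local Open Scope ring_scope.

(* {1, ..., d} is rendered as 'I_d = {0, ..., d-1}, so that {1, ..., k}
   becomes [set i : 'I_d | i < k]. *)
Definition irreducible_perm (d : nat) (pi : 'S_d) : Prop :=
  forall k : nat, (1 <= k <= d)%N ->
    pi @: [set i : 'I_d | (i < k)%N] = [set i : 'I_d | (i < k)%N] -> k = d.

Section Symplectic.
Variables (R : realType) (E : vectType R).

Definition symplectic (H : {vspace E}) (omega : E -> E -> R) : Prop :=
  [/\ forall (a : R) (x y z : E), x \in H -> y \in H -> z \in H ->
        omega (a *: x + y) z = a * omega x z + omega y z,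
      forall (a : R) (x y z : E), x \in H -> y \in H -> z \in H ->
        omega z (a *: x + y) = a * omega z x + omega z y,
      forall x : E, x \in H -> omega x x = 0
    & forall x : E, x \in H ->
        (forall y : E, y \in H -> omega x y = 0) -> x = 0].

Definition in_symplectic_orth (H : {vspace E}) (omega : E -> E -> R)
    (V : {vspace E}) (u : E) : Prop :=
  u \in H /\ (forall v : E, v \in V -> omega u v = 0).

(* The inclusion of V in H is part of the equality V = V^omega. *)
Definition lagrangian (H : {vspace E}) (omega : E -> E -> R)
    (V : {vspace E}) : Prop :=
  forall u : E, u \in V <-> in_symplectic_orth H omega V u.

End Symplectic.

Section PermutationSpaces.
Variables (R : realType) (d : nat) (pi : 'S_d).

Definition Omega : 'M[R]_d :=
  \matrix_(i < d, j < d)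
    (if (i < j)%N && (pi j < pi i)%N then 1
     else if (j < i)%N && (pi i < pi j)%N then -1
     else 0).

Definition Omega_lin : 'Hom('cV[R]_d, 'cV[R]_d) := linfun (mulmx Omega).

Definition Hpi : {vspace 'cV[R]_d} := limg Omega_lin.

(* omega (Omega u) y = u^T y for y in Hpi, where u is recovered from Omega u up
   to an element of the kernel by the partial inverse of Omega_lin;
   omegaE below shows that the choice of u is irrelevant. *)
Definition omega (x y : 'cV[R]_d) : R :=
  (((Omega_lin^-1)%VF x)^T *m y) 0 0.

Definition e_orbit (B : {set 'I_d}) : 'cV[R]_d :=
  \sum_(i in B) delta_mx i 0.

Definition Vpi : {vspace 'cV[R]_d} :=
  <<[seq e_orbit B | B in porbits pi]>>%VS.

Definition HVpi : {vspace 'cV[R]_d} := (Omega_lin @: Vpi)%VS.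

Lemma Omega_linE (u : 'cV[R]_d) : Omega_lin u = Omega *m u.
Proof. by rewrite lfunE. Qed.

Lemma Omega_antisym : Omega^T = - Omega.
Proof.
apply/matrixP=> i j; rewrite !mxE.
by case: (ltngtP i j) => ij /=; case: (ltngtP (pi i) (pi j)) => //=;
  rewrite ?opprK ?oppr0.
Qed.

Lemma mem_HpiP (x : 'cV[R]_d) :
  reflect (exists u : 'cV[R]_d, x = Omega *m u) (x \in Hpi).
Proof.
apply: (iffP memv_imgP) => [[u _ ->]|[u ->]]; exists u => //.
- by rewrite Omega_linE.
- by rewrite memvf.
- by rewrite Omega_linE.
Qed.

Lemma omegaE (u v : 'cV[R]_d) :
  omega (Omega *m u) (Omega *m v) = (u^T *m Omega *m v) 0 0.
Proof.
rewrite /omega mulmxA.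
set w := (Omega_lin^-1)%VF _.
have wE : Omega *m w = Omega *m u.
  by rewrite -Omega_linE limg_lfunVK //; apply/mem_HpiP; exists u.
have tr (z : 'cV[R]_d) : z^T *m Omega = - (Omega *m z)^T.
  by rewrite trmx_mul Omega_antisym mulmxN opprK.
by rewrite !tr wE.
Qed.

Lemma omega_symplectic : symplectic Hpi omega.
Proof.
split.
- move=> a x y z _ _ _.
  by rewrite /omega !linearP /= mulmxDl -scalemxAl !mxE.
- move=> a x y z _ _ _.
  by rewrite /omega mulmxDr -scalemxAr !mxE.
- move=> x /mem_HpiP[u ->]; rewrite omegaE.
  set s := _ 0 0; suff: s = - s.
    by move/eqP; rewrite -addr_eq0 -mulr2n mulrn_eq0 => /eqP.
  rewrite {1}/s -[u^T *m Omega *m u]trmxK mxE !trmx_mul trmxK Omega_antisym.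
  by rewrite mulNmx mulmxN mxE mulmxA.
- move=> x /mem_HpiP[u ->] h.
  have tr0 : u^T *m Omega = 0.
    apply/matrixP=> i j; rewrite [i]ord1 [RHS]mxE.
    have hj : Omega *m delta_mx j 0 \in Hpi.
      by apply/mem_HpiP; exists (delta_mx j 0).
    have := h _ hj; rewrite omegaE -colE => <-.
    by rewrite [RHS]mxE.
  apply: trmx_inj; rewrite trmx_mul Omega_antisym mulmxN tr0.
  by rewrite oppr0 trmx0.
Qed.

Definition lagrangian_perm : Prop := lagrangian Hpi omega HVpi.

End PermutationSpaces.

(* Main.v *)
Require Import Defs.
From mathcomp Require Import all_boot all_order all_fingroup all_algebra.
From mathcomp Require Import reals.

(** The permutation matrix P of the involution pi satisfies P Omega P = - Omega,
    so Omega exchanges the eigenspaces of P for 1 and -1, and the former is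
    V^pi.  Hence u^T Omega v = 0 for u, v in V^pi, which is isotropy.
    Conversely, if Omega u is orthogonal to H^pi_V, let w be the
    antisymmetric part of u: then Omega w lies in V^pi and is
    Euclidean-orthogonal to V^pi, so it vanishes, and Omega u is the image of
    the symmetric part of u. *)

Set Implicit Arguments.
Unset Strict Implicit.
Unset Printing Implicit Defensive.

Import GRing.Theory Num.Theory.
Local Open Scope ring_scope.

Lemma cV_norm_eq0 (R : realDomainType) (n : nat) (w : 'cV[R]_n) :
  (w^T *m w) 0 0 = 0 -> w = 0.
Proof.
rewrite mxE => /eqP; rewrite psumr_eq0 => [/allP w0|i _]; last first.
  by rewrite mxE -expr2 sqr_ge0.
apply/matrixP=> i j; rewrite ord1 mxE; apply/eqP.
by have := w0 i (mem_index_enum i); rewrite mxE mulf_eq0 orbb.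
Qed.

Lemma e_orbitE (R : realType) (d : nat) (B : {set 'I_d}) i :
  e_orbit R B i 0 = (i \in B)%:R.
Proof.
rewrite summxE; have [iB|iB] := boolP (i \in B).
  rewrite (bigD1 i) //= mxE !eqxx big1 ?addr0 // => j /andP[_ ji].
  by rewrite mxE eq_sym (negbTE ji).
rewrite big1 // => j jB; rewrite mxE.
by have [ij|//] := eqVneq i j; rewrite ij jB in iB.
Qed.

(** Being fixed by [row_perm pi] means being constant on the orbits of [pi], hence being a
    combination of the vectors [e_orbit R B]. *)
Lemma mem_VpiP (R : realType) (d : nat) (pi : 'S_d) (v : 'cV[R]_d) :
  reflect (row_perm pi v = v) (v \in Vpi R pi).
Proof.
apply: (iffP idP) => [vV|vE].
  have: v \in fixedSpace (linfun (row_perm pi)).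
    apply: (subvP _ _ vV); apply/span_subvP => _ /imageP[B /imsetP[x _ ->] ->].
    apply/fixedSpaceP; rewrite lfunE; apply/matrixP=> i j.
    rewrite ord1 mxE !e_orbitE -!eq_porbit_mem; congr (_ == _)%:R.
    by have := porbit_perm pi 1 i; rewrite expg1.
  by move/fixedSpaceP; rewrite lfunE.
have vpi i : v (pi i) 0 = v i 0 by rewrite -[in RHS]vE mxE.
have vX i k : v ((pi ^+ k)%g i) 0 = v i 0.
  by elim: k => [|k <-]; rewrite ?expg0 ?perm1 // expgSr permM vpi.
have -> : v = \sum_i v i 0 *: delta_mx i 0.
  by rewrite {1}[v]matrix_sum_delta; apply: eq_bigr => i _; rewrite big_ord1.
rewrite (partition_big (porbit pi) (mem (porbits pi))) /=; last first.
  by move=> i _; apply: imset_f.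
apply: memv_suml => B BP; have /imsetP[x _ BE] := BP.
(* On the orbit [B] of [x] all coefficients of [v] equal [v x 0], so the block of [B] is a multiple
   of [e_orbit R B]. *)
rewrite (_ : \sum_(i | _) _ = v x 0 *: e_orbit R B).
  by apply/memvZ/memv_span/image_f.
rewrite scaler_sumr; apply: eq_big => [i|i /eqP iB].
  by rewrite BE eq_porbit_mem.
by have /porbitP[k ->] : i \in porbit pi x; rewrite -?BE -?iB ?porbit_id ?vX.
Qed.

Section Involution.
Variables (R : realType) (d : nat) (pi : 'S_d).
Hypothesis piV : pi = (pi^-1)%g.

Let piK : involutive pi.
Proof. by move=> i; rewrite {1}piV permK. Qed.

Lemma row_permK_invol : involutive (@row_perm R d 1 pi).
Proof. by move=> v; apply/matrixP=> i j; rewrite !mxE piK. Qed.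

(** As [pi] is an involution, passing to [(pi i, pi j)] swaps the comparison of indices with that of
    images: an inversion remains one, with its orientation reversed. *)
Lemma Omega_perm i j : Omega R pi (pi i) (pi j) = - Omega R pi i j.
Proof.
rewrite !mxE !piK.
by case: (ltngtP i j) => ij /=; case: (ltngtP (pi i) (pi j)) => //=;
  rewrite ?opprK ?oppr0.
Qed.

Lemma row_perm_Omega (v : 'cV[R]_d) :
  row_perm pi (Omega R pi *m v) = - (Omega R pi *m row_perm pi v).
Proof.
apply/matrixP=> i j; rewrite !mxE (reindex_inj (@perm_inj _ pi)) -sumrN.
by apply: eq_bigr => k _; rewrite Omega_perm mulNr [row_perm _ _ _ _]mxE.
Qed.

Lemma row_perm_dot (u v : 'cV[R]_d) :
  ((row_perm pi u)^T *m row_perm pi v) 0 0 = (u^T *m v) 0 0.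
Proof.
rewrite !mxE [RHS](reindex_inj (@perm_inj _ pi)).
by apply: eq_bigr => k _; rewrite !mxE.
Qed.

(** Permuting the coordinates of both [u] and [Omega R pi *m v] preserves their dot product, but
    fixes [u] and negates the other factor. *)
Lemma Vpi_isotropic (u v : 'cV[R]_d) :
  u \in Vpi R pi -> v \in Vpi R pi -> (u^T *m Omega R pi *m v) 0 0 = 0.
Proof.
move=> /mem_VpiP uE /mem_VpiP vE; rewrite -mulmxA.
have := row_perm_dot u (Omega R pi *m v).
rewrite row_perm_Omega uE vE mulmxN [LHS]mxE => /eqP.
by rewrite eq_sym -addr_eq0 -mulr2n mulrn_eq0 => /eqP.
Qed.

Lemma lagrangian_invol : lagrangian_perm R pi.
Proof.
move=> x; split=> [/memv_imgP[u uV ->]|[/mem_HpiP[u ->] uorth]].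
  rewrite Omega_linE; split=> [|y /memv_imgP[v vV ->]].
    by apply/mem_HpiP; exists u.
  by rewrite Omega_linE omegaE Vpi_isotropic.
(* Split [u] into its parts fixed ([u1]) and negated ([w]) by [row_perm pi]. *)
pose u1 := 2^-1 *: (u + row_perm pi u).
pose w := 2^-1 *: (u - row_perm pi u).
have u1V : u1 \in Vpi R pi.
  by apply/mem_VpiP; rewrite linearZ linearD /= row_permK_invol addrC.
have wN : row_perm pi w = - w.
  by rewrite linearZ linearB /= row_permK_invol -scalerN opprB.
have uE : u = u1 + w.
  rewrite -scalerDr addrACA subrr addr0 -mulr2n -scaler_nat scalerA.
  by rewrite mulVf ?scale1r // pnatr_eq0.
have OwV : Omega R pi *m w \in Vpi R pi.
  by apply/mem_VpiP; rewrite row_perm_Omega wN mulmxN opprK.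
have Ow0 : Omega R pi *m w = 0.
  apply: cV_norm_eq0; set v := Omega R pi *m w in OwV *.
  (* Test orthogonality against [Omega R pi *m v]: the [u1] term vanishes by isotropy, and the [w]
     term is minus the squared norm of [v]. *)
  have vH : Omega R pi *m v \in HVpi R pi by rewrite -Omega_linE memv_img.
  have := uorth _ vH; rewrite omegaE uE linearD !mulmxDl mxE.
  rewrite Vpi_isotropic // add0r => wv0.
  rewrite /v trmx_mul Omega_antisym mulmxN mulNmx mxE.
  by rewrite wv0 oppr0.
by rewrite uE mulmxDr Ow0 addr0 -Omega_linE memv_img.
Qed.

End Involution.

Theorem theorem4p16 (R : realType) (d : nat) (pi : 'S_d) :
  (0 < d)%N -> irreducible_perm pi -> pi = (pi^-1)%g -> lagrangian_perm R pi.
Proof. by move=> _ _; apply: lagrangian_invol. Qed.
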